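(* Let $K\subset\mathbb{R}^2$ be the Lévy Dragon. Then the Hausdorff dimension of its topological boundary is greater than one: $\dim_H\partial K>1$.
   Context: Let $f_1(x,y)=\left(\frac{x-y}{2},\frac{x+y}{2}\right)$ and $f_2(x,y)=\left(\frac{x+y+1}{2},\frac{y-x+1}{2}\right)$. The Lévy Dragon $K$ is the attractor of the iterated function system $\{f_1,f_2\}$ on $\mathbb{R}^2$, i.e. the unique nonempty compact set with $K=f_1(K)\cup f_2(K)$. *)

(* Defs.v *)
From HB Require Import structures.
From mathcomp Require Import all_boot all_order all_algebra.
From mathcomp Require Import all_classical all_reals all_analysis.

Set Implicit Arguments.
Unset Strict Implicit.
Unset Printing Implicit Defensive.

Import Order.TTheory GRing.Theory Num.Theory.
Import numFieldNormedType.Exports.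

Local Open Scope classical_set_scope.
Local Open Scope ring_scope.

Definition boundary (T : topologicalType) (A : set T) : set T :=
  closure A `\` interior A.

(* The canonical norm on R * R is the sup norm; it induces the usual topology,
   but diameters below are taken in the Euclidean metric. *)
Definition eucl_dist (R : realType) (p q : R * R) : R :=
  Num.sqrt ((p.1 - q.1) ^+ 2 + (p.2 - q.2) ^+ 2).

Section Hausdorff.
Context {R : realType} {T : Type}.
Variable d : T -> T -> R.
Local Open Scope ereal_scope.

(* diam set0 = -oo *)
Definition diam (A : set T) : \bar R :=
  ereal_sup [set (d x y)%:E | x in A & y in A].

Definition delta_cover (delta : R) (A : set T) (U : (set T)^nat) : Prop :=
  A `<=` \bigcup_i U i /\ forall i, diam (U i) <= delta%:E.

(* Summing over the nonempty U i only makes the empty set contribute 0 for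
   every exponent, including s = 0, and a point contribute 0 `^ 0 = 1. *)
Definition hausdorff_premeasure (s delta : R) (A : set T) : \bar R :=
  ereal_inf [set \esum_(i in [set i | U i !=set0]) diam (U i) `^ s
            | U in delta_cover delta A].

Definition hausdorff_measure (s : R) (A : set T) : \bar R :=
  ereal_sup [set hausdorff_premeasure s delta A
            | delta in [set delta : R | (0 < delta)%R]].

(* Equals +oo when no hausdorff_measure s A vanishes. *)
Definition hausdorff_dim (A : set T) : \bar R :=
  ereal_inf [set s%:E | s in [set s : R | (0 <= s)%R /\
                                          hausdorff_measure s A = 0]].

End Hausdorff.

Definition is_attractor (T : topologicalType) (f g : T -> T) (K : set T) :
    Prop :=
  [/\ K !=set0, compact K & K = (f @` K) `|` (g @` K)].

Definition levy_f1 (R : realType) (p : R * R) : R * R :=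
  ((p.1 - p.2) / 2, (p.1 + p.2) / 2).

Definition levy_f2 (R : realType) (p : R * R) : R * R :=
  ((p.1 + p.2 + 1) / 2, (p.2 - p.1 + 1) / 2).

(* Both maps contract the Euclidean metric by 1 / sqrt 2, so by Hutchinson's
   theorem exactly one set K satisfies this predicate. *)
Definition is_levy_dragon (R : realType) (K : set (R * R)) : Prop :=
  is_attractor (@levy_f1 R) (@levy_f2 R) K.

(* Main.v *)
Require Import Defs.
From mathcomp Require Import all_boot all_order all_algebra.
From mathcomp Require Import all_classical all_reals all_analysis.
From mathcomp Require Import zify ring lra.
Import numFieldNormedType.Exports.

Set Implicit Arguments.
Unset Strict Implicit.
Unset Printing Implicit Defensive.

(* Identify the plane with the complex numbers: f_1 z = (1 + i) z / 2 and
   f_2 z = ((1 - i) z + 1 + i) / 2. The level-n pieces f_w K are indexed by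
   oriented edges of the lattice (1 - i)^-n Z[i], and a fine edge has exactly one
   parent among all the coarse ones, so distinct words give distinct edges and an
   edge whose ancestors miss the dragon is absent from it.

   Some point is covered at level 12 by tiles of the dragon only. Copying it to an
   absent edge of level n gives, at distance O(2^(-n/2)) from that edge, a point
   outside K. Hence a point of K that lies, at every level, in a tile having an
   absent edge in a fixed relative position is a boundary point.

   Let g z = i - z, an edge absent at level 0. There are 18 words w of length 8
   with f_w g = g f_w' for some w', so all concatenations of these words have the
   absent neighbour f_w g. They span a self-similar subset of the boundary made of
   18 maps of ratio 1/16; as its cylinders sit on distinct lattice edges, only
   boundedly many of them are close together, and the dimension is at least
   ln 18 / ln 16 > 1. *)

(** * Arithmetic of edges in the scaled Gaussian lattice *)

Section Edges.
Import Order.TTheory GRing.Theory Num.Theory.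
Local Open Scope ring_scope.

(* At level n, the edge ((a, b), (c, d)) stands for the map
   z |-> (1 - i)^-n ((a + b i) + (c + d i) z). *)
Definition edge := ((int * int) * (int * int))%type.

Implicit Types (e h g : edge) (w : seq bool).

Definition gmul (p q : int * int) : int * int :=
  (p.1 * q.1 - p.2 * q.2, p.1 * q.2 + p.2 * q.1).

Definition gadd (p q : int * int) : int * int := (p.1 + q.1, p.2 + q.2).

Definition gunits : seq (int * int) := [:: (1, 0); (0, 1); (-1, 0); (0, -1)].

Definition edge0 : edge := ((0, 0), (1, 0)).

(** Encodes (1 - i) f_1 z = z and (1 - i) f_2 z = 1 - i z: appending a map multiplies the lattice
    point by 1 - i and, for f_2, also moves it along the edge and turns the direction by -i. *)
Definition child e (i : bool) : edge :=
  if i then (gadd (gmul (1, -1) e.1) e.2, gmul (0, -1) e.2)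
  else (gmul (1, -1) e.1, e.2).

Definition descend e w : edge := foldl child e w.

(* The composition of a level-m edge [e] with a level-n edge [h]. *)
Definition ecomp (n : nat) e h : edge :=
  (gadd (iter n (gmul (1, -1)) e.1) (gmul e.2 h.1), gmul e.2 h.2).

Lemma gmulA p q r : gmul p (gmul q r) = gmul (gmul p q) r.
Proof. by rewrite /gmul /=; congr pair; ring. Qed.

Lemma gmulC p q : gmul p q = gmul q p.
Proof. by rewrite /gmul /=; congr pair; ring. Qed.

Lemma gmulDr p q r : gmul p (gadd q r) = gadd (gmul p q) (gmul p r).
Proof. by rewrite /gmul /gadd /=; congr pair; ring. Qed.

Lemma gaddA p q r : gadd p (gadd q r) = gadd (gadd p q) r.
Proof. by rewrite /gadd /=; congr pair; ring. Qed.

Lemma gmul1 p : gmul (1, 0) p = p.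
Proof. by case: p => a b; rewrite /gmul /=; congr pair; ring. Qed.

Lemma gmul_units p q : p \in gunits -> q \in gunits -> gmul p q \in gunits.
Proof.
by rewrite !inE => /or4P[] /eqP-> /or4P[] /eqP->; vm_compute.
Qed.

Lemma child_units e i : (child e i).2 \in gunits = (e.2 \in gunits).
Proof.
case: i => //=; apply/idP/idP => [h|]; last exact: gmul_units.
have := gmul_units (isT : (0, 1) \in gunits) h.
by rewrite gmulA (_ : gmul (0, 1) (0, -1) = (1, 0)) ?gmul1.
Qed.

Lemma descend_units e w : (descend e w).2 \in gunits = (e.2 \in gunits).
Proof. by elim: w e => //= i w IH e; rewrite IH child_units. Qed.

(** A lattice point times 1 - i has even coordinate sum, and adding a unit makes it odd, so parity
    tells the two kinds of children apart. *)
Lemma child_inj e h i j : e.2 \in gunits -> h.2 \in gunits ->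
  child e i = child h j -> e = h /\ i = j.
Proof.
case: e => [[a b] r]; case: h => [[a' b'] r'] /=.
rewrite !inE => /or4P[] /eqP-> /or4P[] /eqP->; case: i; case: j;
  rewrite /child /gmul /gadd /= => -[] *; (try by lia);
  by split => //; congr (_, _, _); lia.
Qed.

Lemma descend_inj e h w w' : e.2 \in gunits -> h.2 \in gunits ->
  size w = size w' -> descend e w = descend h w' -> e = h /\ w = w'.
Proof.
elim: w e h w' => [|i w IH] e h [|j w'] //= ue uh [sw].
by move=> /IH[]; rewrite ?child_units// => /child_inj[]// -> -> ->.
Qed.

Lemma child_comp n e h i : child (ecomp n e h) i = ecomp n.+1 e (child h i).
Proof.
rewrite /child /ecomp /=; case: i => /=; rewrite !gmulDr ?gaddA !gmulA.
  by rewrite (gmulC (1, -1) e.2) (gmulC (0, -1) e.2).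
by rewrite (gmulC (1, -1) e.2).
Qed.

Lemma descend_comp n e h w :
  descend (ecomp n e h) w = ecomp (size w + n) e (descend h w).
Proof.
elim: w n h => //= i w IH n h.
by rewrite child_comp IH addnS.
Qed.

Lemma descend_cat e w w' : descend e (w ++ w') = descend (descend e w) w'.
Proof. exact: foldl_cat. Qed.

Lemma ecomp0 e : ecomp 0 e edge0 = e.
Proof.
case: e => [[a b] [c d]]; rewrite /ecomp /gmul /gadd /=.
by congr ((_, _), (_, _)); ring.
Qed.

Lemma descendE e w : descend e w = ecomp (size w) e (descend edge0 w).
Proof. by rewrite -[in LHS](ecomp0 e) descend_comp addn0. Qed.

Lemma ecompA n e h g : ecomp 0 (ecomp n e h) g = ecomp n e (ecomp 0 h g).
Proof. by rewrite /ecomp /= gmulDr gaddA !gmulA. Qed.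

(* The edge z |-> i - z, running from i to i - 1. *)
Definition twin : edge := ((0, 1), (-1, 0)).

(* The 18 words w of length 8 for which f_w o twin = twin o f_w' for a word w'
   (again in the list, as twin is an involution). *)
Definition twin_words : seq (seq bool) :=
  let o := false in let l := true in
  [:: [:: o; o; o; o; o; o; o; o]; [:: o; o; o; o; l; l; l; l];
      [:: o; o; o; l; o; l; l; l]; [:: o; o; o; l; l; o; o; l];
      [:: o; o; o; l; l; l; o; o]; [:: o; o; o; l; l; l; l; o];
      [:: o; o; l; o; o; o; l; l]; [:: o; o; l; o; o; l; o; l];
      [:: o; o; l; l; o; o; l; o]; [:: o; l; o; l; o; l; o; l];
      [:: o; l; l; o; o; l; l; o]; [:: o; l; l; l; o; o; o; o];
      [:: l; o; o; o; o; o; l; l]; [:: l; o; o; o; o; l; l; l];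
      [:: l; o; o; o; l; l; l; o]; [:: l; o; o; l; o; o; o; l];
      [:: l; o; o; l; o; o; l; o]; [:: l; o; o; l; o; l; o; o]].

Lemma twin_wordsP w : w \in twin_words ->
  exists2 w', size w' = size w &
    ecomp 0 (descend edge0 w) twin = descend twin w'.
Proof.
have h : all (fun w => has (fun w' => (size w' == size w) &&
    (ecomp 0 (descend edge0 w) twin == descend twin w')) twin_words) twin_words.
  by vm_compute.
by move=> /(allP h)/hasP[w' _ /andP[/eqP ? /eqP ?]]; exists w'.
Qed.

(** * Concatenations of the 18 blocks and their absent neighbours *)

Definition word (v : seq 'I_18) : seq bool :=
  flatten [seq nth [::] twin_words (val i) | i <- v].

Lemma twin_word_in (i : 'I_18) : nth [::] twin_words i \in twin_words.
Proof. exact: mem_nth. Qed.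

Lemma size_twin_word (i : 'I_18) : size (nth [::] twin_words i) = 8.
Proof.
have h : all (fun w => size w == 8) twin_words by [].
exact/eqP/(allP h)/twin_word_in.
Qed.

Lemma size_word v : size (word v) = (8 * size v)%N.
Proof.
by elim: v => //= i v IH; rewrite /word /= size_cat size_twin_word IH mulnS.
Qed.

Lemma word_inj v v' : size v = size v' -> word v = word v' -> v = v'.
Proof.
elim: v v' => [|i v IH] [|j v'] //= [sv] /eqP.
rewrite /word /= eqseq_cat ?size_twin_word// => /andP[/eqP eij /eqP /(IH _ sv)->].
congr cons; apply/val_inj/eqP.
by rewrite -(@nth_uniq _ [::] twin_words) ?ltn_ord// eij.
Qed.

(** The twin g is pushed left through one block at a time: f_v f_i g = f_v g f_u = g f_w' f_u. *)
Lemma twin_word v : exists2 w', size w' = size (word v) &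
  ecomp 0 (descend edge0 (word v)) twin = descend twin w'.
Proof.
elim/last_ind: v => [|v i [w' sw' IH]]; first by exists [::].
have [u su hu] := twin_wordsP (twin_word_in i).
exists (w' ++ u); rewrite /word map_rcons flatten_rcons.
  by rewrite !size_cat sw' su.
rewrite !descend_cat -IH descend_comp addn0 su -hu -ecompA.
by rewrite -descendE.
Qed.

(** The neighbour f_v g descends from [twin], and an edge has only one ancestor at level 0, so it
    cannot descend from [edge0] as well. *)
Lemma twin_absent v w : size w = size (word v) ->
  ecomp 0 (descend edge0 (word v)) twin <> descend edge0 w.
Proof.
have [w' sw' ->] := twin_word v.
by move=> sw /descend_inj[]//; rewrite sw sw'.
Qed.

End Edges.

(** * Lower bound for the Hausdorff dimension from a tree of cylinders *)

Section HausdorffLowerBound.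
Import Order.TTheory GRing.Theory Num.Theory.
Local Open Scope classical_set_scope.
Local Open Scope ring_scope.

Context {R : realType}.

Lemma sum_prefix_rcons m (v w : seq 'I_m) :
  (\sum_(c < m) prefix (rcons v c) w <= prefix v w)%N.
Proof.
have [/prefixP[[|c u] ->]|nv] := boolP (prefix v w).
- rewrite cats0 big1// => c _; case: (boolP (prefix _ _)) => // /prefixP[u].
  by move=> /(congr1 size); rewrite size_cat size_rcons; lia.
- rewrite (bigD1 c)//= -cat_rcons prefix_prefix big1// => c' /negPf cc'.
  case: (boolP (prefix _ _)) => // /prefixP[u'] /eqP.
  rewrite eqseq_cat ?size_rcons// eqseq_rcons eqxx /=.
  by rewrite eq_sym cc'.
- rewrite big1// => c _; case: (boolP (prefix _ _)) => // /prefixP[u wE].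
  by case/negP: nv; rewrite wE cat_rcons prefix_prefix.
Qed.

Lemma sum_count_prefix_rcons m (v : seq 'I_m) (h : seq (seq 'I_m)) :
  (\sum_(c < m) count (prefix (rcons v c)) h <= count (prefix v) h)%N.
Proof.
elim: h => [|w h IH] /=; first by rewrite big1.
by rewrite big_split leq_add// sum_prefix_rcons.
Qed.

(* Each prefix v carries the weight, rescaled by m ^ |v|, of the words extending
   it; since a weight is at least the average of those of its children, the
   branch can be chosen greedily among prefixes of weight < 1. *)
Lemma avoiding_branch m (n : nat -> nat) (h : nat -> seq (seq 'I_m)) :
  (0 < m)%N ->
  (\sum_(0 <= i <oo) ((size (h i))%:R / m%:R ^+ n i : R)%:E < 1)%E ->
  exists b : nat -> 'I_m, forall i, mkseq b (n i) \notin h i.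
Proof.
move=> m0 hsum; have mR0 : 0 < m%:R :> R by rewrite ltr0n.
pose a v i : R := (count (prefix v) (h i))%:R * m%:R ^+ size v / m%:R ^+ n i.
have a0 v i : 0 <= a v i by rewrite /a !mulr_ge0// ?invr_ge0 exprn_ge0// ltW.
pose W v := (\sum_(0 <= i <oo) (a v i)%:E)%E.
have step v : (W v < 1)%E -> exists c, (W (rcons v c) < 1)%E.
  move=> Wv; apply: contrapT => /forallNP Wc.
  (* If every child weighed at least 1, summing over the m children would give m <= m * W v, against
     W v < 1. *)
  have : (m%:R%:E <= m%:R%:E * W v)%E.
    rewrite [leLHS](_ : _ = (\sum_(c < m) 1)%E); last first.
      by rewrite sumEFin sumr_const card_ord.
    apply: (@le_trans _ _ (\sum_(c < m) W (rcons v c))%E).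
      by apply: lee_sum => c _; rewrite leNgt; apply/negP/Wc.
    rewrite /W -nneseries_sum; last by move=> *; rewrite lee_fin.
    rewrite [leRHS](_ : _ = (\sum_(0 <= i <oo) (m%:R%:E * (a v i)%:E))%E); last first.
      by rewrite nneseriesZl// => *; rewrite lee_fin.
    apply: lee_nneseries => [i _ _|i _].
      by apply: sume_ge0 => *; rewrite lee_fin.
    rewrite sumEFin -EFinM lee_fin /a -!mulr_suml.
    under eq_bigr do rewrite size_rcons.
    rewrite -!mulr_suml exprS -!mulrA mulrCA ler_wpM2l ?(ltW mR0)//.
    rewrite ler_wpM2r ?mulr_ge0 ?invr_ge0 ?exprn_ge0 ?(ltW mR0)//.
    by rewrite -natr_sum ler_nat sum_count_prefix_rcons.
  by rewrite -{1}(mule1 m%:R%:E) lee_pmul2l// leNgt Wv.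
have /choice[nxt nxtP] : forall v, exists c,
    (W v < 1)%E -> (W (rcons v c) < 1)%E.
  move=> v.
  have [/step[c]|/negP nW] := boolP (W v < 1)%E; first by exists c.
  by exists (Ordinal m0).
pose s k := iter k (fun v => rcons v (nxt v)) [::].
exists (fun k => nxt (s k)) => i.
have sE k : mkseq (fun k => nxt (s k)) k = s k.
  by elim: k => // k IH; rewrite mkseqS IH.
have Ws k : (W (s k) < 1)%E.
  elim: k => [|k IH]; last exact: nxtP.
  rewrite /W /a/= (eq_eseriesr (g := fun i => ((size (h i))%:R / m%:R ^+ n i)%:E))//.
  move=> j _; rewrite expr0 mulr1 (@eq_count _ _ predT) ?count_predT//.
  by move=> w; rewrite prefix0s.
(* A hit in [h i] makes the i-th term of W at least 1 at the prefix of length [n i], where the two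
   powers of m cancel. *)
apply/negP => hin; have := Ws (n i); apply/negP; rewrite -leNgt.
apply: (@le_trans _ _ (a (s (n i)) i)%:E).
  rewrite lee_fin /a -sE size_mkseq mulfK ?gt_eqF ?exprn_gt0//.
  by rewrite ler1n -has_count; apply/hasP; exists (mkseq (fun k => nxt (s k)) (n i)); rewrite ?prefix_refl.
rewrite /W; apply: le_trans (nneseries_lim_ge i.+1 _); last first.
  by move=> *; rewrite lee_fin.
rewrite big_mkord big_ord_recr/= leeDr// sume_ge0// => *.
by rewrite lee_fin.
Qed.

(** For r > 0, n is the level with N^-(n+1) < r <= N^-n, so (N^s)^-n <= N^s r^s <= N^s r^t. The
    error e serves r = 0, where no such level exists and n is merely taken large. *)
Lemma scale_choice (N s t r e : R) : 1 < N -> 0 < s -> t <= s ->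
  0 <= r <= 1 -> 0 < e ->
  exists n, r <= N ^- n /\ (N `^ s) ^- n <= N `^ s * r `^ t + e.
Proof.
move=> N1 s0 ts /andP[r0 r1] e0; have N0 : 0 < N by lra.
have m1 : 1 < N `^ s.
  by rewrite /powR (gt_eqF N0) expR_gt1 mulr_gt0// ln_gt0.
have M0 : 0 < N `^ s by lra.
have exp_small (x f : R) : 1 < x -> 0 < f -> exists n, x ^- n < f.
  move=> x1 f0.
  have x0 : 0 < x by lra.
  have : x^-1 ^+ n @[n --> \oo] --> (0 : R).
    by apply: cvg_expr; rewrite ger0_norm ?invr_ge0 ?ltW ?invf_lt1.
  move=> /cvgr_lt/(_ _ f0)[n _ /(_ n (leqnn n))] /=.
  by rewrite exprVn; exists n.
move: r0; rewrite le_eqVlt => /predU1P[<-|r0].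
  have [n hn] := exp_small _ _ m1 e0; exists n; split.
    by rewrite invr_ge0 exprn_ge0// ltW.
  by rewrite (le_trans (ltW hn))// lerDr mulr_ge0 ?powR_ge0.
have [n0 hn0] : exists n, N ^- n.+1 < r.
  have [n hn] := exp_small _ _ N1 r0; exists n; apply: le_lt_trans hn.
  by rewrite lef_pV2 ?posrE ?exprn_gt0// ler_eXn2l.
have ex : exists n, N ^- n.+1 < r by exists n0.
exists (ex_minn ex); case: ex_minnP => n hn hmin; split.
  case: n hn hmin => [|n] hn hmin; first by rewrite expr0 invr1.
  by rewrite leNgt; apply/negP => /hmin; rewrite ltnn.
rewrite -[leLHS]addr0 lerD ?(ltW e0)//.
have -> : (N `^ s) ^- n = N `^ s * (N ^- n.+1) `^ s.
  rewrite -!powR_invn ?(ltW N0) ?(ltW M0)// -!powRrM -powRD; last first.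
    by rewrite (gt_eqF N0) implybT.
  by congr powR; rewrite -natr1; ring.
rewrite ler_pM2l//; apply: (@le_trans _ _ (r `^ s)).
  by apply: ge0_ler_powR; rewrite ?nnegrE ?invr_ge0 ?exprn_ge0 ?(ltW N0) ?(ltW s0) ?(ltW r0) ?(ltW hn).
by rewrite ger_powR// r0.
Qed.

(** A mass distribution argument without a measure. If the t-dimensional measure vanished for some t
    < s, there would be a cover of small sum, each piece blocking at most M cylinders of a level
    matched to its diameter. The blocked words weigh less than 1 in total, so some branch avoids
    them all, and its point is uncovered. *)
Theorem hausdorff_dim_ge_tree (T : Type) (d : T -> T -> R) (A : set T)
    (m M : nat) (N s : R) (C : seq 'I_m -> set T) :
  (forall x y, 0 <= d x y) -> 1 < N -> 0 < s -> N `^ s = m%:R ->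
  (forall b : nat -> 'I_m, exists2 x, A x & forall n, C (mkseq b n) x) ->
  (forall (U : set T) n (h : seq (seq 'I_m)), uniq h ->
    (forall v, v \in h -> size v = n /\ C v `&` U !=set0) ->
    (forall x y, U x -> U y -> d x y <= N ^- n) -> (size h <= M)%N) ->
  (s%:E <= hausdorff_dim d A)%E.
Proof.
move=> d0 N1 s0 Ns hC hM; have m0 : (0 < m)%N.
  by rewrite -(ltr_nat R) -Ns powR_gt0// (lt_trans _ N1).
have mR0 : 0 < m%:R :> R by rewrite ltr0n.
apply: le_ereal_inf_tmp => _ /= [t [t0 Ht0] <-]; rewrite lee_fin leNgt.
apply/negP => ts.
(* [K * eta] and [M.+1 * e] both equal 1/4, and the errors e / 2 ^ i.+1 add up to e, so the blocked
   weight is at most 1/2. Using [M.+1] keeps the constants positive when M = 0. *)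
pose K : R := m%:R * M.+1%:R; have K0 : 0 < K by rewrite mulr_gt0.
pose e : R := (4 * M.+1%:R)^-1; have e0 : 0 < e by rewrite invr_gt0 mulr_gt0.
pose eta : R := (4 * K)^-1; have eta0 : 0 < eta by rewrite invr_gt0 mulr_gt0.
(* Taking delta = 1 puts the diameters of nonempty pieces in [0, 1], as [scale_choice] requires. *)
have : (hausdorff_premeasure d t 1 A < eta%:E)%E.
  apply: (@le_lt_trans _ _ 0%E); last by rewrite lte_fin.
  by rewrite -Ht0; apply: ereal_sup_ubound; exists 1 => //=; exact: ltr01.
move=> /ereal_inf_lt[_ /= [U [AU dU] <-]] Ulte.
(* An empty piece has diameter -oo; it gets the value 0 instead. *)
pose r i : R := if `[< U i !=set0 >] then fine (diam d (U i)) else 0.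
have rP i : U i !=set0 -> diam d (U i) = (r i)%:E.
  move=> U0; rewrite /r asboolT// fineK// fin_numE; apply/andP; split.
    case: U0 => x Ux; rewrite gt_eqF// (lt_le_trans (ltNyr (d x x)))//.
    by apply: ereal_sup_ubound; exists x => //; exists x.
  by rewrite lt_eqF// (le_lt_trans (dU i))// ltry.
have r01 i : 0 <= r i <= 1.
  have [U0|U0] := pselect (U i !=set0); last by rewrite /r asboolF// lexx ler01.
  rewrite -!lee_fin -rP// dU andbT; case: U0 => x Ux.
  apply: (@le_trans _ _ (d x x)%:E); rewrite ?lee_fin//.
  by apply: ereal_sup_ubound; exists x => //; exists x.
have /choice[n nP] : forall i, exists n, r i <= N ^- n /\
    m%:R ^- n <= m%:R * r i `^ t + e / (2 ^ i.+1)%:R.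
  move=> i; rewrite -Ns; apply: scale_choice => //; first exact: ltW.
  by rewrite divr_gt0// ltr0n expn_gt0.
pose h i := [seq v <- [seq tval w | w <- enum {: (n i).-tuple 'I_m}]
              | `[< C v `&` U i !=set0 >] ].
have hsize i : (size (h i) <= M)%N.
  apply: (hM (U i) (n i)).
  - by rewrite filter_uniq// map_inj_uniq ?enum_uniq//; exact: val_inj.
  - move=> v; rewrite mem_filter => /andP[/asboolP CU /mapP[w _ vE]].
    by split=> //; rewrite vE size_tuple.
  - move=> x y Ux Uy; apply: le_trans (nP i).1.
    rewrite -lee_fin -rP; last by exists x.
    by apply: ereal_sup_ubound; exists x => //; exists y.
have h0 i : ~ (U i !=set0) -> size (h i) = 0%N.
  move=> U0; rewrite /h (eq_filter (a2 := pred0)) ?filter_pred0// => v.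
  by apply/asboolP => -[x [_ Ux]]; apply: U0; exists x.
have [b bP] : exists b : nat -> 'I_m, forall i, mkseq b (n i) \notin h i.
  apply: avoiding_branch => //.
  pose f i : \bar R := if i \in [set i | U i !=set0] then (diam d (U i) `^ t)%E else 0%E.
  have f0 i : (0 <= f i)%E by rewrite /f; case: ifP => // _; exact: poweR_ge0.
  apply: (@le_lt_trans _ _
    (\sum_(0 <= i <oo) (K%:E * f i + (4^-1 / (2 ^ i.+1)%:R)%:E))%E).
    apply: lee_nneseries => [i _ _|i _].
      by rewrite lee_fin divr_ge0// exprn_ge0// ltW.
    have e4 : M.+1%:R * e = 4^-1 by rewrite /e invfM mulrCA mulfV ?mulr1.
    have [U0|U0] := pselect (U i !=set0); last first.
      rewrite h0// mul0r; apply: adde_ge0; last by rewrite lee_fin divr_ge0.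
      by rewrite mule_ge0// lee_fin ltW.
    rewrite /f mem_set// rP// poweR_EFin -EFinM -EFinD lee_fin.
    apply: (@le_trans _ _ (M.+1%:R * m%:R ^- n i)).
      by rewrite ler_wpM2r ?invr_ge0 ?exprn_ge0 ?(ltW mR0)// ler_nat ltnW// ltnS.
    apply: (@le_trans _ _ (M.+1%:R * (m%:R * r i `^ t + e / (2 ^ i.+1)%:R))).
      by rewrite ler_wpM2l//; exact: (nP i).2.
    by rewrite mulrDr !mulrA e4 /K [M.+1%:R * _]mulrC.
  apply: (le_lt_trans (epsilon_trick _ _ _)) => //.
    by move=> i; rewrite mule_ge0// lee_fin ltW.
  rewrite nneseriesZl// nneseries_esumT// -esum_mkcond.
  apply: (@le_lt_trans _ _ (K%:E * eta%:E + 4^-1%:E)%E).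
    by rewrite leeD2r// lee_pmul2l// ltW.
  rewrite -EFinM -EFinD lte_fin /eta invfM mulrCA mulfV ?gt_eqF// mulr1.
  lra.
have [x Ax Cx] := hC b; have [i _ Ux] := AU x Ax.
have /negP := bP i; apply; rewrite mem_filter; apply/andP; split.
  by apply/asboolP; exists x; split.
have sb : size (mkseq b (n i)) == n i by rewrite size_mkseq.
by apply/mapP; exists (Tuple sb); rewrite ?mem_enum.
Qed.

End HausdorffLowerBound.

(** * Edges acting on the plane *)

Section LevyDragon.
Import Order.TTheory GRing.Theory Num.Theory.
Local Open Scope classical_set_scope.
Local Open Scope ring_scope.

Context {R : realType}.
Implicit Types (z q : R * R) (e h : edge) (w u : seq bool).

Definition levy (i : bool) z : R * R := if i then levy_f2 z else levy_f1 z.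

Definition levyw w z : R * R := foldr levy z w.

(* Multiplication by 1 - i, which turns level-n edges into level-0 ones. *)
Definition sigma z : R * R := (z.1 + z.2, z.2 - z.1).

(** In complex notation, z |-> (a + b i) + (c + d i) z: the edge read at level 0. *)
Definition act e z : R * R :=
  (e.1.1%:~R + e.2.1%:~R * z.1 - e.2.2%:~R * z.2,
   e.1.2%:~R + e.2.2%:~R * z.1 + e.2.1%:~R * z.2).

Lemma act0 z : act edge0 z = z.
Proof. by case: z => x y; rewrite /act /=; congr pair; ring. Qed.

Lemma sigma_act_levy e i z : sigma (act e (levy i z)) = act (child e i) z.
Proof.
by case: i; rewrite /sigma /act /levy /levy_f1 /levy_f2 /child /gmul /gadd /=;
  congr pair; field.
Qed.

Lemma iter_sigma_act e w z :
  iter (size w) sigma (act e (levyw w z)) = act (descend e w) z.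
Proof.
by elim: w e => // i w IH e; rewrite [size _]/= iterSr /= sigma_act_levy IH.
Qed.

Lemma iter_sigma_levyw w z :
  iter (size w) sigma (levyw w z) = act (descend edge0 w) z.
Proof. by rewrite -iter_sigma_act act0. Qed.

Lemma act_act e h z : act e (act h z) = act (ecomp 0 e h) z.
Proof. by rewrite /act /ecomp /gadd /gmul /=; congr pair; ring. Qed.

Lemma iter_sigma_translate n e z :
  iter n sigma (act e z) =
  act (iter n (gmul (1, -1)) e.1, e.2) (iter n sigma z).
Proof.
elim: n => [|n IH]; first by rewrite -surjective_pairing.
rewrite !iterS IH /sigma /act /=; congr pair; ring.
Qed.

Lemma act_inj e : e.2 \in gunits -> injective (act e).
Proof.
case: e => [[a b] r] /=; rewrite !inE => /or4P[] /eqP-> [x y] [x' y'];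
  rewrite /act /= => -[h1 h2]; by congr pair; lra.
Qed.

(** (1 - i)^4 = -4, which gives the factor 16 for each block of eight letters. *)
Lemma iter_sigma4 n z :
  iter n.+4 sigma z = (- 4 * (iter n sigma z).1, - 4 * (iter n sigma z).2).
Proof. by rewrite !iterS; case: (iter n sigma z) => x y; congr pair; rewrite /=; ring. Qed.

Lemma iter_sigma8 n z : iter (8 * n) sigma z = (16 ^+ n * z.1, 16 ^+ n * z.2).
Proof.
elim: n => [|n IH]; first by rewrite !expr0 !mul1r -surjective_pairing.
by rewrite mulnS !iter_sigma4 IH !exprS; congr pair; rewrite /=; ring.
Qed.

Definition levy_box z : bool := (- 2^-1 <= z.1 <= 3 / 2) && (- 4^-1 <= z.2 <= 1).

(* Found by computer search: a point all of whose level-12 neighbouring tiles are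
   tiles of the dragon. *)
Definition inner_point : R * R := (325 / 512, 437 / 512).

Lemma iter_sigma_inner_point :
  iter 12 sigma inner_point = (- (325 / 8), - (437 / 8)).
Proof. by rewrite !iter_sigma4 /inner_point; congr pair; rewrite /=; field. Qed.

Lemma int_range (a lo hi : int) : (lo%:~R < a%:~R :> R) && (a%:~R < hi%:~R :> R) -> lo < a < hi.
Proof. by rewrite !ltr_int. Qed.

(** For each of the four directions, the size of the box leaves two possible lattice points. [L]
    gives a word for each of the eight resulting edges. *)
Lemma inner_point_full h z : h.2 \in gunits -> levy_box z ->
  act h z = iter 12 sigma inner_point ->
  exists2 u, size u = 12 & h = descend edge0 u.
Proof.
rewrite iter_sigma_inner_point.
pose o := false; pose l := true.
pose L := [:: [:: l; o; o; l; o; l; l; l; l; l; o; l];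
  [:: l; o; o; l; o; l; l; l; l; l; l; o];
  [:: l; o; o; l; l; o; o; o; o; o; o; o];
  [:: o; l; l; l; o; o; l; o; l; o; l; l];
  [:: l; o; l; o; o; o; l; o; o; l; l; l];
  [:: o; l; l; l; o; o; l; o; l; l; o; o];
  [:: l; o; l; o; o; o; l; o; l; o; l; o];
  [:: l; o; l; o; o; o; l; o; l; o; o; l]].
move=> hu hz hE; suff : h \in map (descend edge0) L.
  move=> /mapP[u uL ->]; exists u => //.
  have hL : all (fun w => size w == 12) L by [].
  exact/eqP/(allP hL).
have -> : map (descend edge0) L =
    [:: ((-42, -55), (1, 0)); ((-41, -55), (1, 0));
        ((-40, -56), (0, 1)); ((-40, -55), (0, 1));
        ((-41, -54), (-1, 0)); ((-40, -54), (-1, 0));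
        ((-41, -55), (0, -1)); ((-41, -54), (0, -1))] by vm_compute.
case: h hu hE => [[a b] r] /=; case: z hz => x y /andP[/= /andP[x0 x1] /andP[y0 y1]].
move=> hu [h1 h2].
have {hu} : [|| r == (1, 0), r == (0, 1), r == (-1, 0) | r == (0, -1)].
  by move: hu; rewrite !inE.
move=> /or4P[] /eqP rE; move: h1 h2; rewrite rE /= => h1 h2.
- have /int_range ha : ((-43)%:~R < a%:~R :> R) && (a%:~R < (-40)%:~R :> R) by apply/andP; split; lra.
  have /int_range hb : ((-56)%:~R < b%:~R :> R) && (b%:~R < (-54)%:~R :> R) by apply/andP; split; lra.
  have -> : b = -55 by lia.
  by have [->|->] : a = -42 \/ a = -41 by lia.
- have /int_range ha : ((-41)%:~R < a%:~R :> R) && (a%:~R < (-39)%:~R :> R) by apply/andP; split; lra.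
  have /int_range hb : ((-57)%:~R < b%:~R :> R) && (b%:~R < (-54)%:~R :> R) by apply/andP; split; lra.
  have -> : a = -40 by lia.
  by have [->|->] : b = -56 \/ b = -55 by lia.
- have /int_range ha : ((-42)%:~R < a%:~R :> R) && (a%:~R < (-39)%:~R :> R) by apply/andP; split; lra.
  have /int_range hb : ((-55)%:~R < b%:~R :> R) && (b%:~R < (-53)%:~R :> R) by apply/andP; split; lra.
  have -> : b = -54 by lia.
  by have [->|->] : a = -41 \/ a = -40 by lia.
- have /int_range ha : ((-42)%:~R < a%:~R :> R) && (a%:~R < (-40)%:~R :> R) by apply/andP; split; lra.
  have /int_range hb : ((-56)%:~R < b%:~R :> R) && (b%:~R < (-53)%:~R :> R) by apply/andP; split; lra.
  have -> : a = -41 by lia.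
  by have [->|->] : b = -55 \/ b = -54 by lia.
Qed.

Lemma continuous_levyw w : continuous (levyw w).
Proof.
elim: w => [|i w IH] z /=; first exact: cvg_id.
have c1 : (levyw w z).1 @[z --> z] --> (levyw w z).1.
  exact: cvg_comp (IH z) cvg_fst.
have c2 : (levyw w z).2 @[z --> z] --> (levyw w z).2.
  exact: cvg_comp (IH z) cvg_snd.
case: i; rewrite /levy /levy_f1 /levy_f2.
  exact: cvg_pair (cvgMr_tmp (cvgD (cvgD c1 c2) (cvg_cst _)))
                  (cvgMr_tmp (cvgD (cvgB c2 c1) (cvg_cst _))).
exact: cvg_pair (cvgMr_tmp (cvgB c1 c2)) (cvgMr_tmp (cvgD c1 c2)).
Qed.

Lemma levyw_cat w w' z : levyw (w ++ w') z = levyw w (levyw w' z).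
Proof. exact: foldr_cat. Qed.

Lemma le_eucl_dist (x y : R * R) :
  `|x.1 - y.1| <= eucl_dist x y /\ `|x.2 - y.2| <= eucl_dist x y.
Proof.
rewrite /eucl_dist -!sqrtr_sqr.
by split; apply: ler_wsqrtr; rewrite ?lerDl ?lerDr sqr_ge0.
Qed.

Lemma act_contract e z z' : e.2 \in gunits ->
  `|(act e z).1 - (act e z').1| <= `|z.1 - z'.1| + `|z.2 - z'.2| /\
  `|(act e z).2 - (act e z').2| <= `|z.1 - z'.1| + `|z.2 - z'.2|.
Proof.
case: e => [[a b] r] /=; case: z => x y; case: z' => x' y'.
have /ler_normlP[? ?] := lexx `|x - x'|; have /ler_normlP[? ?] := lexx `|y - y'|.
rewrite /act /= !inE => /or4P[] /eqP-> /=; rewrite !ler_norml;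
  by split; apply/andP; split; lra.
Qed.

(** * Tiles of the dragon, its bounding box, and points outside it *)

Variables (K : set (R * R)) (hK : is_levy_dragon K).

Lemma dragon_split z : K z -> exists i, exists2 y, K y & z = levy i y.
Proof.
case: hK => _ _ {1}-> [[y Ky <-]|[y Ky <-]]; [exists false|exists true]; by exists y.
Qed.

Lemma dragon_levyw w z : K z -> K (levyw w z).
Proof.
move=> Kz; elim: w => //= i w IH; case: hK => _ _ ->.
by case: i; [right | left]; exists (levyw w z).
Qed.

Lemma dragon_splitn n z : K z ->
  exists2 w, size w = n & exists2 y, K y & z = levyw w y.
Proof.
elim: n z => [|n IH] z Kz; first by exists [::] => //; exists z.
have [i [y Ky ->]] := dragon_split Kz.
by have [w sw [x Kx ->]] := IH y Ky; exists (i :: w); rewrite /= ?sw//; exists x.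
Qed.

(* Two steps of the system multiply by 1/2 and a power of i, so the distance to
   the box is halved. *)
Lemma dragon_box z : K z -> levy_box z.
Proof.
pose near_box (M : R) z := (- 2^-1 - M <= z.1 <= 3 / 2 + M) &&
  (- 4^-1 - M <= z.2 <= 1 + M).
have [M0 M00 hM0] : exists2 M, 0 <= M & forall z, K z -> near_box M z.
  have [M [_ hM]] : bounded_set K by case: hK => _ /compact_bounded.
  have M1 : M < `|M| + 1 by rewrite ltr_pwDr ?ler_norm.
  exists (`|M| + 1); first by rewrite addr_ge0.
  move=> [x y] Kxy; have : Num.max `|x| `|y| <= `|M| + 1 := hM _ M1 _ Kxy.
  rewrite /near_box/= ge_max => /andP[].
  rewrite !ler_norml => /andP[? ?] /andP[? ?].
  by apply/andP; split; apply/andP; split; lra.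
have half M : (forall z, K z -> near_box M z) ->
    forall z, K z -> near_box (M / 2) z.
  move=> h z' /(dragon_splitn 2)[[|i [|j []]]//= _ [[x y] /h /andP[/=]]].
  move=> /andP[? ?] /andP[? ?] ->.
  by case: i; case: j; rewrite /near_box /levy /levy_f1 /levy_f2 /=;
    apply/andP; split; apply/andP; split; lra.
have hn n : forall z, K z -> near_box (M0 / 2 ^+ n) z.
  elim: n => [|n IH]; first by rewrite expr0 divr1.
  by rewrite exprSr invfM mulrA; exact: half.
have small (f : R) : 0 < f -> exists n, M0 / 2 ^+ n < f.
  move=> f0.
  have : M0 * 2^-1 ^+ n @[n --> \oo] --> (M0 * 0 : R).
    by apply: cvgMl_tmp; apply: cvg_expr; rewrite ger0_norm ?invr_ge0 ?invf_lt1//; lra.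
  rewrite mulr0 => /cvgr_lt/(_ _ f0)[n _ /(_ n (leqnn n))] /=.
  by rewrite exprVn; exists n.
move=> Kz; rewrite /levy_box; case: z Kz => x y Kz /=.
by apply/andP; split; apply/andP; split; rewrite leNgt; apply/negP => hlt;
  have := hlt; rewrite -subr_gt0 => /small[n];
  have /andP[/andP[/= ? ?] /andP[/= ? ?]] := hn n _ Kz; lra.
Qed.

Definition gconj (r : int * int) : int * int := (r.1, - r.2).

Lemma gconjK r : r \in gunits -> gmul r (gconj r) = (1, 0).
Proof. by rewrite !inE => /or4P[] /eqP->; vm_compute. Qed.

Lemma ecomp0_translate n e h :
  ecomp 0 (iter n (gmul (1, -1)) e.1, e.2) h = ecomp n e h.
Proof. by []. Qed.

(** Units are invertible, so a fine edge has coordinates relative to any coarse edge, whether or not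
    it descends from it. *)
Lemma ecomp_surj n e h : e.2 \in gunits -> h.2 \in gunits ->
  exists2 h', h'.2 \in gunits & h = ecomp n e h'.
Proof.
move=> eu hu; set P := iter n (gmul (1, -1)) e.1.
exists (gmul (gconj e.2) (gadd h.1 (gmul (-1, 0) P)), gmul (gconj e.2) h.2).
  rewrite gmul_units//.
  by move: eu; rewrite !inE => /or4P[] /eqP->; vm_compute.
rewrite /ecomp /= !gmulA gconjK// !gmul1 -/P.
case: h {hu} => [[a b] r] /=; congr pair.
by rewrite /gadd /gmul /=; congr pair; ring.
Qed.

(* The inner point of a tile that is absent at level n lies outside K. *)
Lemma inner_point_dragon e n z : e.2 \in gunits ->
  iter n sigma z = act e inner_point -> K z ->
  exists2 w, size w = n & e = descend edge0 w.
Proof.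
move=> eu ze /(dragon_splitn (n + 12))[v sv [y Ky zE]].
have hu : (descend edge0 v).2 \in gunits by rewrite descend_units.
have [h' hu' hE] := ecomp_surj 12 eu hu.
have [] := @inner_point_full h' y hu' (dragon_box Ky).
  have eu' : (iter 12 (gmul (1, -1)) e.1, e.2).2 \in gunits by [].
  apply: (act_inj eu'); rewrite -iter_sigma_translate -ze -iterD addnC -sv zE.
  by rewrite iter_sigma_levyw act_act ecomp0_translate hE.
(* The tile containing z descends both from [e] and from the level-n prefix of [v], in 12 steps
   each; uniqueness of ancestors identifies the two. *)
move=> u su h'E; exists (take n v); first by rewrite size_takel// sv leq_addr.
have : descend (descend edge0 (take n v)) (drop n v) = descend e u.
  by rewrite -descend_cat cat_take_drop hE h'E [RHS]descendE su.
move=> /descend_inj[|||->]//; first by rewrite descend_units.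
by rewrite size_drop sv su addKn.
Qed.

(** * Cylinders of the 18 blocks: boundary points and multiplicity *)

Definition cylinder (v : seq 'I_18) : set (R * R) := levyw (word v) @` K.

Lemma closed_cylinder v : closed (cylinder v).
Proof.
apply: compact_closed; first exact: norm_hausdorff.
apply: continuous_compact; last by case: hK.
by apply: continuous_subspaceT; exact: continuous_levyw.
Qed.

Lemma cylinder_cat v v' : cylinder (v ++ v') `<=` cylinder v.
Proof.
move=> _ [z Kz <-]; rewrite /word map_cat flatten_cat levyw_cat.
by exists (levyw (word v') z) => //; exact: dragon_levyw.
Qed.

Lemma cylinder_scale v z : iter (8 * size v) sigma (levyw (word v) z) =
  act (descend edge0 (word v)) z.
Proof. by rewrite -size_word iter_sigma_levyw. Qed.

(** The images of one point of K along the branch cluster in K; from index n on they stay in the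
    n-th cylinder, which is closed. *)
Lemma branch_point (b : nat -> 'I_18) : exists x, forall n, cylinder (mkseq b n) x.
Proof.
case: (hK) => [[z0 Kz0] cK _].
pose x_ n := levyw (word (mkseq b n)) z0.
have [x [_ Fx]] : K `&` cluster (x_ @ \oo) !=set0.
  by apply: cK; exists 0%N => // n _; exact: dragon_levyw.
exists x => n; apply: closed_cylinder; move: Fx; rewrite clusterE; apply.
exists n => // k /= nk; rewrite -(subnKC nk).
rewrite /x_ /mkseq iotaD map_cat; apply: (@cylinder_cat _ _ _).
by exists z0.
Qed.

Lemma branch_boundary (b : nat -> 'I_18) x :
  (forall n, cylinder (mkseq b n) x) -> boundary K x.
Proof.
move=> bx; split.
  by apply: subset_closure; have [z Kz <-] := bx 0%N; exact: dragon_levyw.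
rewrite /interior /= => /nbhs_ballP[f /= f0 hf].
(* The image of [y0] under [levyw (word v)] is the inner point of the absent neighbour f_v g. A ball
   around x inside K would contain it for large n. *)
pose y0 : R * R := act twin inner_point.
have [n nf] : exists n, 10 / 16 ^+ n < f.
  have : 10 * 16^-1 ^+ n @[n --> \oo] --> (10 * 0 : R).
    by apply: cvgMl_tmp; apply: cvg_expr; rewrite ger0_norm ?invr_ge0 ?invf_lt1//; lra.
  rewrite mulr0 => /cvgr_lt/(_ _ f0)[n _ /(_ n (leqnn n))] /=.
  by rewrite exprVn; exists n.
set v := mkseq b n; have [z Kz zx] := bx n.
have vn : size v = n by rewrite size_mkseq.
have eu : (descend edge0 (word v)).2 \in gunits by rewrite descend_units.
suff Ky : K (levyw (word v) y0).
  have := @inner_point_dragon (ecomp 0 (descend edge0 (word v)) twin)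
    (size (word v)) _ _ _ Ky.
  case; first by rewrite /ecomp /= gmul_units.
    by rewrite iter_sigma_levyw /y0 act_act.
  by move=> w sw /(twin_absent sw).
apply: hf; rewrite -zx.
have [] := act_contract z y0 eu.
rewrite -!cylinder_scale !iter_sigma8 /= -!mulrBr !normrM vn.
have p0 : 0 < 16 ^+ n :> R by rewrite exprn_gt0.
rewrite !(ger0_norm (ltW p0)) => d1 d2.
(* A generous bound: both z and [y0] lie near the unit square. *)
have dB : `|z.1 - y0.1| + `|z.2 - y0.2| <= 10.
  have /andP[/andP[? ?] /andP[? ?]] := dragon_box Kz.
  have : `|z.1 - y0.1| <= 5 by rewrite ler_norml /y0 /act /=; apply/andP; split; lra.
  have : `|z.2 - y0.2| <= 5 by rewrite ler_norml /y0 /act /=; apply/andP; split; lra.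
  lra.
by split; rewrite /ball /=; apply: le_lt_trans nf; rewrite ler_pdivlMr// mulrC; lra.
Qed.

Lemma act_near e z : e.2 \in gunits -> levy_box z ->
  `|(act e z).1 - e.1.1%:~R| <= 3 / 2 /\ `|(act e z).2 - e.1.2%:~R| <= 3 / 2.
Proof.
case: e => [[a b] r]; case: z => x y.
rewrite /act /= !inE => hr /andP[/andP[/= ? ?] /andP[/= ? ?]].
by move: hr => /or4P[] /eqP-> /=; rewrite !ler_norml;
  split; apply/andP; split; lra.
Qed.

(** After scaling by 16^n the two points are at distance at most 1, and each coordinate is within
    3/2 of that of its lattice point: 3/2 + 1 + 3/2 = 4. *)
Lemma cylinder_position n v v' x x' : size v = n -> size v' = n ->
  cylinder v x -> cylinder v' x' -> eucl_dist x x' <= 16 ^- n ->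
  `|(descend edge0 (word v)).1.1 - (descend edge0 (word v')).1.1| <= 4 /\
  `|(descend edge0 (word v)).1.2 - (descend edge0 (word v')).1.2| <= 4.
Proof.
move=> sv sv' [z Kz zx] [z' Kz' zx'].
have p16 : 0 < 16 ^+ n :> R by rewrite exprn_gt0.
rewrite -[_ ^- n]mul1r ler_pdivlMr// => d0.
have [d1 d2] := le_eucl_dist x x'.
have {d1} := le_trans (ler_wpM2r (ltW p16) d1) d0.
have {d2 d0} := le_trans (ler_wpM2r (ltW p16) d2) d0.
rewrite -(ger0_norm (ltW p16)) -!normrM !mulrBl ![_ * 16 ^+ n]mulrC.
have := cylinder_scale v z; have := cylinder_scale v' z'.
rewrite !iter_sigma8 sv sv' zx zx' => e1 e2.
have {e1}[-> ->] := e1; have {e2}[-> ->] := e2.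
have eu : (descend edge0 (word v)).2 \in gunits by rewrite descend_units.
have eu' : (descend edge0 (word v')).2 \in gunits by rewrite descend_units.
have := act_near eu' (dragon_box Kz'); have := act_near eu (dragon_box Kz).
move: (descend _ _) (descend _ _) => e e' /=; rewrite !ler_norml.
by move=> [/andP[? ?] /andP[? ?]] [/andP[? ?] /andP[? ?]] /andP[? ?] /andP[? ?];
  split; apply/andP; split; rewrite -(ler_int R) intrB; lra.
Qed.

(** 324 = 9 * 9 * 4: offsets from -4 to 4 in each coordinate and four directions. Distinct words of
    equal length give distinct edges, so counting edges suffices. *)
Lemma cylinder_multiplicity (U : set (R * R)) n (h : seq (seq 'I_18)) :
  uniq h -> (forall v, v \in h -> size v = n /\ cylinder v `&` U !=set0) ->
  (forall x y, U x -> U y -> eucl_dist x y <= 16 ^- n) ->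
  (size h <= 324)%N.
Proof.
case: h => // v0 h' uh hh dU; set h := v0 :: h' in uh hh *.
have [s0 [x0 [Cx0 Ux0]]] : size v0 = n /\ cylinder v0 `&` U !=set0.
  by apply: hh; rewrite mem_head.
pose E v := descend edge0 (word v); pose p0 := (E v0).1.
pose S : seq int := [seq k%:Z - 4 | k <- iota 0 9].
pose L : seq (int * int) := [seq gadd p0 (i, j) | i <- S, j <- S].
have -> : 324%N = size [seq (p, r) | p <- L, r <- gunits].
  by rewrite !size_allpairs !size_map size_iota.
rewrite -(size_map E); apply: uniq_leq_size.
  rewrite map_inj_in_uniq// => v v' /hh[sv _] /hh[sv' _].
  rewrite /E => /descend_inj[]//; first by rewrite !size_word sv sv'.
  by move=> _; apply: word_inj; rewrite sv sv'.
move=> _ /mapP[v vh ->]; rewrite [E v]surjective_pairing.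
apply: allpairs_f; last by rewrite /E descend_units.
have [sv [x [Cx Ux]]] := hh v vh.
have [] := cylinder_position sv s0 Cx Cx0 (dU _ _ Ux Ux0).
rewrite -/(E v) -/(E v0) -/p0 => h1 h2.
have -> : (E v).1 = gadd p0 ((E v).1.1 - p0.1, (E v).1.2 - p0.2).
  by rewrite /gadd /= !(addrC p0.1, addrC p0.2) !subrK -surjective_pairing.
have inS (i : int) : `|i| <= 4 -> i \in S.
  move=> hi; apply/mapP; exists (absz (i + 4)); last lia.
  by rewrite mem_iota; lia.
by apply: (allpairs_f (fun i j => gadd p0 (i, j))); exact: inS.
Qed.

Lemma dragon_boundary_dim : (1%:E < hausdorff_dim (@eucl_dist R) (boundary K))%E.
Proof.
have l16 : 0 < ln 16 :> R by rewrite ln_gt0// ltr1n.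
have l18 : ln 16 < ln 18 :> R by rewrite ltr_ln ?posrE ?ltr_nat.
apply: (@lt_le_trans _ _ (ln 18 / ln 16 : R)%:E).
  by rewrite lte_fin ltr_pdivlMr// mul1r.
apply: (@hausdorff_dim_ge_tree _ _ _ _ 18 324 16 _ cylinder).
- by move=> x y; exact: sqrtr_ge0.
- by rewrite ltr1n.
- by rewrite divr_gt0// (lt_trans l16).
- by rewrite /powR gt_eqF// mulfVK ?gt_eqF// lnK// posrE.
- move=> b; have [x bx] := branch_point b.
  by exists x => //; exact: branch_boundary bx.
- exact: cylinder_multiplicity.
Qed.

End LevyDragon.

Theorem mainTheorem2 (R : realType) (K : set (R * R)) (hK : is_levy_dragon K) :
  (1%E < hausdorff_dim (@eucl_dist R) (boundary K))%E.
Proof. exact: dragon_boundary_dim. Qed.
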